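(* Let $g>0$, $c_L,c_R>0$, $u_L,u_R,a_L,a_R\in\mathbb{R}$, and put $\hat u=\frac{u_L+u_R}{2}$, $\hat c=\frac{c_L+c_R}{2}$, $\hat\lambda_1=\hat u-\hat c$, $\hat\lambda_2=\hat u+\hat c$. Suppose that $\hat\lambda_1>0$. Choose the wave speeds $\lambda_1,\lambda_2$ as follows: $$\text{if } a_R>a_L:\qquad \lambda_1=\hat\lambda_1,\qquad \lambda_2=\hat\lambda_2;$$ $$\text{if } a_R<a_L:\qquad \lambda_1=\max\left(\hat\lambda_1,\ -\frac{g(a_R-a_L)\hat\lambda_2}{4c_L\hat\lambda_2-g(a_R-a_L)}\right),\qquad \lambda_2=\hat\lambda_2.$$ Then in both cases the intermediate state $Y^*$ of the approximate Riemann solver with wave speeds $\lambda_1,\lambda_2$ (torrential configuration with both speeds positive) has nonnegative celerity, i.e. $c^*_l\ge 0$ and $c^*_r\ge 0$.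
   Context: Setting: one-dimensional shallow-water equations with topography in celerity-velocity variables $Y=(2c,u,a)^T$, where $c=\sqrt{gh}$ is the celerity ($h$ water height), $u$ the velocity, $a$ the bottom height and $g>0$ the gravitational acceleration. At an interface, with left state $Y_L=(2c_L,u_L,a_L)^T$ and right state $Y_R=(2c_R,u_R,a_R)^T$ (outside dry zones, so $c_L,c_R>0$), one considers the linearized Riemann problem $\partial_tY+A(\hat Y)\partial_xY=0$, $Y(x,0)=Y_L$ for $x<0$ and $Y_R$ for $x>0$, where $A(Y)=\begin{pmatrix}u&c&0\\c&u&g\\0&0&0\end{pmatrix}$ and $\hat Y=\frac{Y_L+Y_R}{2}$. The eigenvalues of $A(\hat Y)$ are $0$, $\hat\lambda_1=\hat u-\hat c$ and $\hat\lambda_2=\hat u+\hat c$. Approximate solver with wave speeds $\lambda_1,\lambda_2>0$ (torrential configuration with both speeds positive; $\lambda_1,\lambda_2$ replace $\hat\lambda_1,\hat\lambda_2$): let $$r_0=\left(\tfrac{g(\lambda_2-\lambda_1)}{2},\,-\tfrac{g(\lambda_2+\lambda_1)}{2},\,\lambda_2\lambda_1\right)^T,\qquad l_0=\left(0,0,\tfrac{1}{\lambda_2\lambda_1}\right)^T .$$ The intermediate state $Y^*$ consists of the two states on the left and right of the interface $x=0$, $$Y^*_l=Y_L,\qquad Y^*_r=Y^*_l+\big(l_0\cdot(Y_R-Y_L)\big)r_0 ,$$ and its celerities $c^*_l,c^*_r$ are defined by letting $2c^*_l$ and $2c^*_r$ be the first components of $Y^*_l$ and $Y^*_r$; that is,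 $$2c^*_l=2c_L,\qquad 2c^*_r=2c_L+\frac{g(a_R-a_L)(\lambda_2-\lambda_1)}{2\lambda_2\lambda_1}.$$ *)

(* Defs.v *)
From HB Require Import structures.
From mathcomp Require Import all_boot all_order all_algebra.
From mathcomp Require Import reals.

Set Implicit Arguments.
Unset Strict Implicit.
Unset Printing Implicit Defensive.

Import Order.TTheory GRing.Theory Num.Theory.
Local Open Scope ring_scope.

(* State vector Y = (2c, u, a)^T: its first component is twice the celerity. *)
Definition sw_state (R : realType) (c u a : R) : 'cV[R]_3 :=
  \col_(i < 3) [:: 2 * c; u; a]`_i.

Definition celerity (R : realType) (Y : 'cV[R]_3) : R := Y 0 0 / 2.

Definition dot3 (R : realType) (v w : 'cV[R]_3) : R := \sum_(i < 3) v i 0 * w i 0.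

(* Right and left eigenvectors of the stationary wave (speed 0), with the
   speeds u - c and u + c of the linearized system replaced by l1 and l2. *)
Definition eigvec_r0 (R : realType) (g l1 l2 : R) : 'cV[R]_3 :=
  \col_(i < 3) [:: g * (l2 - l1) / 2; - (g * (l2 + l1) / 2); l2 * l1]`_i.

Definition eigvec_l0 (R : realType) (l1 l2 : R) : 'cV[R]_3 :=
  \col_(i < 3) [:: 0; 0; 1 / (l2 * l1)]`_i.

(* Intermediate states on the two sides of x = 0 when 0 < l1 and 0 < l2: only
   the stationary wave then separates them, the other two waves lying in x > 0. *)
Definition Ystar_l (R : realType) (YL : 'cV[R]_3) : 'cV[R]_3 := YL.

Definition Ystar_r (R : realType) (g l1 l2 : R) (YL YR : 'cV[R]_3) : 'cV[R]_3 :=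
  Ystar_l YL + dot3 (eigvec_l0 l1 l2) (YR - YL) *: eigvec_r0 g l1 l2.

(* Main.v *)
Require Import Defs.
From HB Require Import structures.
From mathcomp Require Import all_boot all_order all_algebra.
From mathcomp Require Import reals.
From mathcomp Require Import ring lra.

(** Only the stationary wave separates the two intermediate states, so the left
    celerity is [cL] itself and the right one is a single fraction with positive
    denominator [4 * (l1 * l2)], whose numerator is
    [4 cL l1 l2 + g (aR - aL) (l2 - l1)] ([celerity_Ystar_r]).
    Over a rising bottom every term of the numerator is nonnegative, because
    [l2 - l1] is twice the mean celerity.  Over a falling bottom, put
    [d = - g (aR - aL) > 0]; as a function of [l1] the numerator is the increasing
    affine map [l1 (4 cL l2 + d) - d l2], whose root is exactly the threshold
    that the second argument of the maximum imposes on [l1]. *)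

Import Order.TTheory GRing.Theory Num.Theory.
Local Open Scope ring_scope.

Lemma celerity_sw_state (R : realType) (c u a : R) :
  celerity (sw_state c u a) = c.
Proof. by rewrite /celerity mxE /= mulrC mulKf // pnatr_eq0. Qed.

Lemma celerity_Ystar_r (R : realType) (g l1 l2 cL uL aL cR uR aR : R) :
  l1 != 0 -> l2 != 0 ->
  celerity (Ystar_r g l1 l2 (sw_state cL uL aL) (sw_state cR uR aR)) =
  (4 * cL * l1 * l2 + g * (aR - aL) * (l2 - l1)) / (4 * (l1 * l2)).
Proof.
move=> l1_neq0 l2_neq0.
rewrite /celerity /Ystar_r /Ystar_l /dot3 !big_ord_recl big_ord0 !mxE /=.
by field; rewrite l1_neq0 l2_neq0.
Qed.

Lemma celerity_Ystar_r_ge0 (R : realType) (g l1 l2 cL uL aL cR uR aR : R) :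
  0 < l1 -> 0 < l2 ->
  0 <= 4 * cL * l1 * l2 + g * (aR - aL) * (l2 - l1) ->
  0 <= celerity (Ystar_r g l1 l2 (sw_state cL uL aL) (sw_state cR uR aR)).
Proof.
move=> l1_gt0 l2_gt0 num_ge0; rewrite celerity_Ystar_r ?gt_eqF //.
by rewrite divr_ge0 // !mulr_ge0 // ltW.
Qed.

Theorem proposition4p5 (R : realType) (g cL cR uL uR aL aR : R)
  (hg : 0 < g) (hcL : 0 < cL) (hcR : 0 < cR) :
  let YL := sw_state cL uL aL in
  let YR := sw_state cR uR aR in
  let hatu := (uL + uR) / 2 in
  let hatc := (cL + cR) / 2 in
  let hatl1 := hatu - hatc in
  let hatl2 := hatu + hatc in
  0 < hatl1 ->
  forall l1 l2 : R,
    (aL < aR /\ l1 = hatl1 /\ l2 = hatl2) \/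
    (aR < aL /\
     l1 = Num.max hatl1
            (- (g * (aR - aL) * hatl2 / (4 * cL * hatl2 - g * (aR - aL)))) /\
     l2 = hatl2) ->
    0 <= celerity (Ystar_l YL) /\ 0 <= celerity (Ystar_r g l1 l2 YL YR).
Proof.
move=> YL YR hatu hatc hatl1 hatl2 hatl1_gt0 l1 l2 speeds.
split; first by rewrite celerity_sw_state ltW.
have hatl_le : hatl1 <= hatl2 by rewrite /hatl1 /hatl2 /hatc; lra.
have hatl2_gt0 : 0 < hatl2 := lt_le_trans hatl1_gt0 hatl_le.
(* With its body visible, [hatl1] is itself a difference that [subr_ge0] rewrites. *)
clearbody hatl1 hatl2.
case: speeds => [[aLR [-> ->]] | [aRL [l1E ->]]].
  apply: celerity_Ystar_r_ge0 => //.
  by rewrite addr_ge0 // !mulr_ge0 ?subr_ge0 // ltW.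
have l1_gt0 : 0 < l1 by rewrite l1E lt_max hatl1_gt0.
apply: celerity_Ystar_r_ge0 => //.
have slope_gt0 : 0 < 4 * cL * hatl2 - g * (aR - aL).
  by rewrite -mulrN opprB addr_gt0 // !mulr_gt0 // subr_gt0.
have : - (g * (aR - aL) * hatl2 / (4 * cL * hatl2 - g * (aR - aL))) <= l1.
  by rewrite l1E le_max lexx orbT.
rewrite -mulNr ler_pdivrMr // -subr_ge0; congr (0 <= _); ring.
Qed.
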